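(* Let $m$ and $n$ be integers with $2\le m\le n$. If $n\le 2m-2$, then $L(m,n)\le n-1$.
   Context: Let $m,n$ be integers with $2\le m\le n$. An $m$ by $n$ array consists of $mn$ cells arranged in $m$ rows and $n$ columns, each cell containing exactly one symbol (symbols are arbitrary and may repeat). A transversal of an array consists of $m$ cells, one from each row and no two from the same column. A latin transversal is a transversal in which no symbol appears more than once. $L(m,n)$ denotes the largest integer such that every $m$ by $n$ array in which each symbol appears at most $L(m,n)$ times has a latin transversal. *)

(* Defs.v *)
From mathcomp Require Import all_boot matrix.
From mathcomp Require Import boolp classical_sets.

Set Implicit Arguments.
Unset Strict Implicit.
Unset Printing Implicit Defensive.

Definition cell (m n : nat) : finType := ('I_m * 'I_n)%type.

Definition transversal (m n : nat) (t : {set cell m n}) : Prop :=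
  [/\ #|t| = m,
      forall i : 'I_m, #|[set c in t | c.1 == i]| = 1
    & {in t &, injective (fun c : cell m n => c.2)}].

Definition latin_transversal (T : eqType) (m n : nat) (A : 'M[T]_(m, n))
    (t : {set cell m n}) : Prop :=
  transversal t /\ {in t &, injective (fun c : cell m n => A c.1 c.2)}.

Definition occurrences (T : eqType) (m n : nat) (A : 'M[T]_(m, n)) (s : T) :
    nat :=
  #|[set c : cell m n | A c.1 c.2 == s]|.

Definition forces_latin_transversal (m n k : nat) : Prop :=
  forall (T : eqType) (A : 'M[T]_(m, n)),
    (forall s : T, occurrences A s <= k) ->
    exists t : {set cell m n}, latin_transversal A t.

Definition is_L (m n l : nat) : Prop :=
  forces_latin_transversal m n l /\
  forall k : nat, forces_latin_transversal m n k -> k <= l.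

(* The default value 0 is never used when 2 <= m <= n: see [L_spec]. *)
Definition L (m n : nat) : nat := xget 0 (is_L m n).

Lemma forces_latin_transversal0 (m n : nat) :
  0 < m -> 0 < n -> forces_latin_transversal m n 0.
Proof.
move=> m0 n0 T A h; pose c : cell m n := (Ordinal m0, Ordinal n0).
have := h (A c.1 c.2); rewrite leqn0 cards_eq0 => /eqP h0.
have : c \in [set d : cell m n | A d.1 d.2 == A c.1 c.2] by rewrite inE.
by rewrite h0 inE.
Qed.

Lemma forces_latin_transversal_bound (m n k : nat) :
  1 < m -> forces_latin_transversal m n k -> k <= m * n.
Proof.
move=> m1 h; rewrite leqNgt; apply/negP => lk.
have [|t [[tm _ _] inj]] := h unit (const_mx tt).
  move=> s; apply: leq_trans (ltnW lk).
  by apply: leq_trans (max_card _) _; rewrite card_prod !card_ord.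
move: m1; rewrite -tm => /card_gt1P[c [d [ct dt /eqP]]]; apply.
by apply: inj => //; rewrite !mxE.
Qed.

Lemma L_spec (m n : nat) : 2 <= m -> m <= n -> is_L m n (L m n).
Proof.
move=> m2 mn.
have ex : exists k, `[< forces_latin_transversal m n k >].
  exists 0; apply/asboolP; apply: forces_latin_transversal0.
    exact: ltnW.
  by apply: leq_trans mn; apply: ltnW.
have ub k : `[< forces_latin_transversal m n k >] -> k <= m * n.
  by move=> /asboolP; apply: forces_latin_transversal_bound.
case: (ex_maxnP ex ub) => l /asboolP hl lmax.
apply: (@xgetPex _ 0 (is_L m n)); exists l; split => // k hk.
by apply: lmax; apply/asboolP.
Qed.

(* Main.v *)
Require Import Defs.
From mathcomp Require Import all_boot.
From mathcomp Require Import matrix zify.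

(** It suffices to exhibit an [m] by [n] array without latin transversal in
    which each symbol appears at most [n] times.  Take the rows as symbols;
    in row [i], put [i] in the first [m - 1] columns (the left ones) and the
    cyclic successor of [i] in the remaining [n - m + 1] columns (the right
    ones).  Each column contains each symbol once, so each symbol appears at
    most [n] times ([shift_array_occurrences]).  If a latin transversal uses a
    right column in row [i], then it already contains the symbol of the
    left cells of the next row, so it uses a right column there too; going
    round cyclically, it uses right columns in all rows.  Hence a latin
    transversal uses either left columns only or right columns only, but there
    are fewer than [m] of either kind, since [n <= 2 * m - 2]. *)

(** The array of the counterexample, with [m = p.+1]: columns of index less
    than [p] are the left ones. *)
Definition shift_array (p n : nat) : 'M['I_p.+1]_(p.+1, n) :=
  \matrix_(i, j) (if j < p then i else ordS i).

Lemma shift_array_occurrences (p n : nat) (s : 'I_p.+1) :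
  occurrences (shift_array p n) s <= n.
Proof.
rewrite /occurrences -[leqRHS]card_ord.
rewrite -(card_in_imset (f := snd)) ?max_card //.
move=> [i j] [i' j']; rewrite !inE !mxE /= => /eqP hi /eqP hi' ejj.
rewrite -ejj in hi' *; congr pair.
by case: ifP hi hi' => _ <- // /ordS_inj.
Qed.

Lemma card_ord_interval (n a b : nat) :
  #|[set j : 'I_n | a <= j < b]| <= b - a.
Proof.
rewrite cardE -(size_map val) -[leqRHS](size_iota a).
apply: uniq_leq_size; first by rewrite (map_inj_uniq val_inj) enum_uniq.
move=> x /mapP[j]; rewrite mem_enum inE mem_iota => hj -> /=; lia.
Qed.

Lemma transversal_row (m n : nat) (t : {set cell m n}) (i : 'I_m) :
  Defs.transversal t -> exists2 c, c \in t & c.1 = i.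
Proof.
case=> _ row _; have /eqP/cards1P[c hc] := row i.
have : c \in [set d in t | d.1 == i] by rewrite hc set11.
by rewrite inE => /andP[ct /eqP ci]; exists c.
Qed.

Lemma transversal_row_inj (m n : nat) (t : {set cell m n}) :
  Defs.transversal t -> {in t &, injective (fun c : cell m n => c.1)}.
Proof.
case=> _ row _ c d ct dt /= cd; have /eqP/cards1P[e he] := row d.1.
have : c \in [set e] by rewrite -he inE ct cd eqxx.
have : d \in [set e] by rewrite -he inE dt eqxx.
by rewrite !inE => /eqP -> /eqP ->.
Qed.

Lemma transversal_interval (m n a b : nat) (t : {set cell m n}) :
  Defs.transversal t -> (forall c, c \in t -> a <= c.2 < b) -> m <= b - a.
Proof.
case=> tm _ col hab; rewrite -[leqLHS]tm -(card_in_imset col).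
apply: leq_trans (card_ord_interval n a b); apply: subset_leq_card.
by apply/subsetP => j /imsetP[c ct ->]; rewrite inE hab.
Qed.

Lemma iter_ordS (m k : nat) (i : 'I_m) : iter k (@ordS m) i = (i + k) %% m :> nat.
Proof.
elim: k => [|k IHk]; first by rewrite addn0 modn_small.
by rewrite iterS /= IHk -addn1 modnDml addn1 addnS.
Qed.

Lemma ordS_connect (m : nat) (i j : 'I_m) : exists k, iter k (@ordS m) i = j.
Proof.
exists (m - i + j); apply: val_inj; rewrite /= iter_ordS addnA subnKC.
  by rewrite modnDl modn_small.
exact: ltnW.
Qed.

Lemma shift_array_no_latin_transversal (p n : nat) (t : {set cell p.+1 n}) :
  n <= 2 * p -> ~ latin_transversal (shift_array p n) t.
Proof.
move=> hn [tr inj].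
have next c : c \in t -> p <= c.2 ->
    exists2 d, d \in t & d.1 = ordS c.1 /\ p <= d.2.
  move=> ct pc; have [d dt d1] := transversal_row _ _ _ (ordS c.1) tr.
  exists d => //; split=> //; rewrite leqNgt; apply/negP => dp.
  (* otherwise [c] and [d] carry the same symbol, so they coincide *)
  have cd : c = d by apply: inj => //; rewrite !mxE dp ltnNge pc d1.
  by move: dp; rewrite -cd ltnNge pc.
have [/existsP[c /andP[ct pc]]|noright] :=
    boolP [exists c, (c \in t) && (p <= c.2)].
  have right k : exists2 d, d \in t & d.1 = iter k (@ordS _) c.1 /\ p <= d.2.
    elim: k => [|k [d dt [d1 pd]]]; first by exists c.
    by have [e et [e1 pe]] := next d dt pd; exists e => //; rewrite e1 d1.
  have : p.+1 <= n - p.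
    apply: (transversal_interval _ _ _ _ _ tr) => d dt; rewrite ltn_ord andbT.
    have [k hk] := ordS_connect _ c.1 d.1; have [e et [e1 pe]] := right k.
    by rewrite (transversal_row_inj _ _ _ tr d e) //= e1 hk.
  lia.
have : p.+1 <= p - 0.
  apply: (transversal_interval _ _ _ _ _ tr) => c ct /=; rewrite ltnNge.
  by apply: contra noright => pc; apply/existsP; exists c; rewrite ct.
by rewrite subn0 ltnn.
Qed.

Theorem theorem1 (m n : nat) (hm : 2 <= m) (hmn : m <= n)
    (hn : n <= 2 * m - 2) : L m n <= n - 1.
Proof.
have [forced _] := L_spec hm hmn.
rewrite leqNgt; apply/negP => ltnL.
case: m hm hmn hn forced ltnL => // p hm hmn hn forced ltnL.
have [|t] := forced _ (shift_array p n).
  move=> s; apply: leq_trans (shift_array_occurrences p n s) _; lia.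
apply: shift_array_no_latin_transversal; lia.
Qed.
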